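(* Let $\pi_H=\{N^H_1\le N^H_2\le\dots\le N^H_r\}$ and $\pi_K=\{N^K_1\le N^K_2\le\dots\le N^K_s\}$, $\sum_{j=1}^r N^H_j=\sum_{i=1}^s N^K_i=N$, be two different non-decreasing partitions of $N$ with $N^H_j\ge 2$ and $N^K_i\ge 2$ for all $1\le j\le r$, $1\le i\le s$. Let $H=O(N^H_1)\times\dots\times O(N^H_r)$, $K=O(N^K_1)\times\dots\times O(N^K_s)$ be the corresponding maximal orthogonal Borel subgroups, or respectively $H=SO(N^H_1)\times\dots\times SO(N^H_r)$, $K=SO(N^K_1)\times\dots\times SO(N^K_s)$ the corresponding maximal connected orthogonal Borel subgroups. Then $\pi_H$ and $\pi_K$ do not contain a common partition of any $N'<N$ if and only if $\langle H,K\rangle=O(N)$, or respectively $\langle H,K\rangle=SO(N)$ when $H,K$ are connected.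
   Context: All groups act blockwise on $\mathbb{R}^N$ on consecutive blocks of coordinates with respect to one fixed orthonormal basis of $\mathbb{R}^N$. $\pi_H$ and $\pi_K$ contain a common partition of $N'<N$ if there exist $1\le a\le r$, $1\le b\le s$ with $\sum_{j=1}^a N^H_j=\sum_{i=1}^b N^K_i=N'$. $\langle H,K\rangle$ is the closed subgroup of $O(N)$ topologically generated by $H$ and $K$. *)

(* Defs.v *)
From HB Require Import structures.
From mathcomp Require Import all_boot all_order all_algebra.
From mathcomp Require Import all_classical all_reals all_analysis.

Set Implicit Arguments.
Unset Strict Implicit.
Unset Printing Implicit Defensive.

Import Order.TTheory GRing.Theory Num.Theory.
Import numFieldNormedType.Exports.

Local Open Scope classical_set_scope.
Local Open Scope ring_scope.

(* Elements of O(N) are written as matrices in the fixed orthonormal basis. *)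
Definition orthogonal_group (R : realType) (N : nat) : set 'M[R]_N :=
  [set A | A *m A^T = 1%:M].

Definition special_orthogonal_group (R : realType) (N : nat) : set 'M[R]_N :=
  [set A | orthogonal_group A /\ \det A = 1].

(* G_(p_1) x ... x G_(p_r) as block-diagonal matrices of size
   N = p_1 + ... + p_r; the cast only reindexes along this equality. *)
Definition block_group (R : realType) (G : forall n : nat, set 'M[R]_n)
    (N r : nat) (p : r.-tuple nat) (sum_p : (\sum_(j < r) tnth p j)%N = N) :
    set 'M[R]_N :=
  [set A | exists2 B : forall j : 'I_r, 'M[R]_(tnth p j),
     (forall j, G (tnth p j) (B j)) &
     A = castmx (sum_p, sum_p) (\mxdiag_(j < r) B j)].

(* O(N) is closed in the space of all matrices, so being closed in O(N) is the
   same as being closed in 'M[R]_N. *)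
Definition closed_subgroup (R : realType) (N : nat) (G : set 'M[R]_N) : Prop :=
  [/\ G `<=` @orthogonal_group R N,
      G 1%:M,
      forall A B, G A -> G B -> G (A *m B),
      forall A, G A -> G (invmx A) &
      closed G].

Definition topologically_generated (R : realType) (N : nat)
    (H K : set 'M[R]_N) : set 'M[R]_N :=
  smallest (@closed_subgroup R N) (H `|` K).

Definition common_partition (r s : nat) (p : r.-tuple nat) (q : s.-tuple nat)
    (N' : nat) : Prop :=
  exists a b : nat,
    [/\ (1 <= a <= r)%N, (1 <= b <= s)%N,
        (\sum_(j < r | (j < a)%N) tnth p j)%N = N' &
        (\sum_(i < s | (i < b)%N) tnth q i)%N = N'].

(* Main.v *)
(* Only the cut points (partial sums) of the two partitions matter.  If no cut
   point 0 < c < N is shared, any two consecutive basis vectors lie in a common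
   block of H or of K, so the generated group contains all rotations in the
   planes (e_i, e_(i+1)), and Givens elimination writes every element of SO(N)
   as a product of these; for O(N) one adds a reflection of H.  If a cut point c
   is shared, the generated group lies in the closed subgroup preserving
   R^c + R^(N-c), which omits the quarter turn in the plane (e_(c-1), e_c). *)
Require Import Defs.
From HB Require Import structures.
From mathcomp Require Import all_boot all_order all_algebra.
From mathcomp Require Import ring lra zify.
From mathcomp Require Import all_classical all_reals all_analysis.

Set Implicit Arguments.
Unset Strict Implicit.
Unset Printing Implicit Defensive.

Import Order.TTheory GRing.Theory Num.Theory.
Import numFieldNormedType.Exports.

Local Open Scope classical_set_scope.
Local Open Scope ring_scope.

(** * Plane rotations *)

Definition givens (R : pzRingType) (n : nat) (a b : 'I_n) (c s : R) : 'M[R]_n :=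
  \matrix_(i, j)
    if i == a then c * (a == j)%:R + s * (b == j)%:R
    else if i == b then - s * (a == j)%:R + c * (b == j)%:R
    else (i == j)%:R.

Lemma sum_indicatorl (R : pzRingType) (n : nat) (a : 'I_n) (f : 'I_n -> R) :
  \sum_j (a == j)%:R * f j = f a.
Proof.
rewrite (bigD1 a) //= eqxx mul1r big1 ?addr0 // => j.
by rewrite eq_sym => /negPf ->; rewrite mul0r.
Qed.

Lemma givens_mulE (R : pzRingType) (n m : nat) (a b : 'I_n) (c s : R)
    (A : 'M[R]_(n, m)) i j :
  (givens a b c s *m A) i j =
    if i == a then c * A a j + s * A b j
    else if i == b then - s * A a j + c * A b j
    else A i j.
Proof.
have lin (u v : R) :
    \sum_k (u * (a == k)%:R + v * (b == k)%:R) * A k j = u * A a j + v * A b j.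
  under eq_bigr do rewrite mulrDl -!mulrA.
  by rewrite big_split /= -!mulr_sumr !(sum_indicatorl _ (A^~ j)).
rewrite mxE; under eq_bigr do rewrite mxE.
case: ifP => _; first exact: lin.
case: ifP => _; first exact: lin.
exact: (sum_indicatorl _ (A^~ j)).
Qed.

(** The pairs multiply like the complex numbers c + i s. Rotations are parametrised by cosine and
    sine instead of an angle, so the addition formulas are polynomial identities. *)
Lemma givens_mul (R : comPzRingType) (n : nat) (a b : 'I_n) (c s c' s' : R) :
  a != b ->
  givens a b c s *m givens a b c' s' =
    givens a b (c * c' - s * s') (c * s' + s * c').
Proof.
move=> /negPf ab; apply/matrixP => i j; rewrite givens_mulE !mxE !eqxx.
rewrite (eq_sym b a) ab.
by case: (i == a); [ring | case: (i == b); [ring |]].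
Qed.

Lemma givens_tr (R : pzRingType) (n : nat) (a b : 'I_n) (c s : R) :
  a != b -> (givens a b c s)^T = givens a b c (- s).
Proof.
move=> /negPf ab; apply/matrixP => i j; rewrite !mxE opprK.
rewrite !(eq_sym a) !(eq_sym b) (eq_sym i j).
case: (eqVneq i a) => [->|ia]; case: (eqVneq j a) => [->|ja];
  rewrite ?eqxx ?ab ?(negPf ia) ?(negPf ja) ?mulr0 ?mulr1 ?addr0 ?add0r //.
- by case: (j == b); rewrite ?mulr0 ?mulr1.
- by rewrite (eq_sym a i) (negPf ia); case: (i == b); rewrite ?mulr0 ?mulr1.
- case: (eqVneq i b) => [->|ib]; case: (eqVneq j b) => jb;
    by rewrite ?jb ?eqxx ?(negPf jb) ?mulr0 ?mulr1 // (eq_sym b) (negPf ib).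
Qed.

Lemma givens1 (R : pzRingType) (n : nat) (a b : 'I_n) :
  givens a b 1 0 = 1%:M :> 'M[R]_n.
Proof.
apply/matrixP => i j; rewrite !mxE oppr0 !mul0r !mul1r addr0 add0r.
by case: eqVneq => [->|_] //; case: eqVneq => [->|_].
Qed.

Lemma det_orthogonal_sqr (R : realType) (n : nat) (A : 'M[R]_n) :
  orthogonal_group A -> \det A ^+ 2 = 1.
Proof. by move=> AA; rewrite expr2 -{2}det_tr -det_mulmx AA det1. Qed.

Lemma orthogonal_mulTmx (R : realType) (n : nat) (A : 'M[R]_n) :
  orthogonal_group A -> A^T *m A = 1%:M.
Proof. exact: mulmx1C. Qed.

Lemma orthogonal_mul (R : realType) (n : nat) (A B : 'M[R]_n) :
  orthogonal_group A -> orthogonal_group B -> orthogonal_group (A *m B).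
Proof.
rewrite /orthogonal_group /= => AA BB.
by rewrite trmx_mul mulmxA -(mulmxA A) BB mulmx1.
Qed.

Lemma special_orthogonal_mul (R : realType) (n : nat) (A B : 'M[R]_n) :
  special_orthogonal_group A -> special_orthogonal_group B ->
  special_orthogonal_group (A *m B).
Proof.
move=> [oA dA] [oB dB]; split; first exact: orthogonal_mul.
by rewrite det_mulmx dA dB mulr1.
Qed.

Lemma givens_orthogonal (R : realType) (n : nat) (a b : 'I_n) (c s : R) :
  a != b -> c ^+ 2 + s ^+ 2 = 1 -> orthogonal_group (givens a b c s).
Proof.
move=> ab cs; rewrite /orthogonal_group /= givens_tr // givens_mul //.
rewrite (_ : c * c - s * - s = 1); last by rewrite -cs; ring.
by rewrite (_ : c * - s + s * c = 0) ?givens1 //; ring.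
Qed.

(** The half-angle formulas: [u] and [v] are the absolute values of the cosine and sine of half the
    angle. They give 2uv = |s|, so the sign of s is put on [v]. *)
Lemma half_angle (R : rcfType) (c s : R) : c ^+ 2 + s ^+ 2 = 1 ->
  exists c' s' : R,
    [/\ c' ^+ 2 + s' ^+ 2 = 1, c = c' * c' - s' * s' & s = c' * s' + s' * c'].
Proof.
move=> cs; pose u := Num.sqrt ((1 + c) / 2); pose v := Num.sqrt ((1 - c) / 2).
have u2 : u ^+ 2 = (1 + c) / 2 by rewrite sqr_sqrtr //; nra.
have v2 : v ^+ 2 = (1 - c) / 2 by rewrite sqr_sqrtr //; nra.
have uv : u * v = `|s| / 2.
  have /eqP : (u * v) ^+ 2 = (`|s| / 2) ^+ 2.
    rewrite exprMn u2 v2 exprMn real_normK ?num_real //.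
    by rewrite (_ : s ^+ 2 = 1 - c ^+ 2); [field | rewrite -cs; ring].
  by rewrite eqrXn2 ?mulr_ge0 ?sqrtr_ge0 ?divr_ge0 // => /eqP.
have vu : v * u = `|s| / 2 by rewrite mulrC.
have [s0|s0] := leP 0 s.
  exists u, v; rewrite -!expr2 u2 v2 uv vu ger0_norm //.
  by split; field.
exists u, (- v); rewrite mulrNN mulrN mulNr uv vu ltr0_norm // sqrrN.
by rewrite -!expr2 u2 v2; split; field.
Qed.

(* Being a square is a determinant-free reason for a rotation, and for each of
   its diagonal blocks, to have determinant 1. *)
Lemma givens_square (R : realType) (n : nat) (a b : 'I_n) (c s : R) :
  a != b -> c ^+ 2 + s ^+ 2 = 1 ->
  exists c' s' : R, c' ^+ 2 + s' ^+ 2 = 1 /\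
    givens a b c s = givens a b c' s' *m givens a b c' s'.
Proof.
move=> ab /half_angle [c' [s' [cs' -> ->]]]; exists c', s'; split => //.
by rewrite givens_mul.
Qed.

Lemma givens_special_orthogonal (R : realType) (n : nat) (a b : 'I_n)
    (c s : R) :
  a != b -> c ^+ 2 + s ^+ 2 = 1 -> special_orthogonal_group (givens a b c s).
Proof.
move=> ab cs; split; first exact: givens_orthogonal.
have [c' [s' [cs' ->]]] := givens_square ab cs.
by rewrite det_mulmx -expr2 det_orthogonal_sqr //; exact: givens_orthogonal.
Qed.

(** One elimination step: (x, y) is turned onto the nonnegative first half-axis. The sign matters
    because it later forces a pivot to be 1 rather than -1. *)
Lemma exists_rotation (R : rcfType) (x y : R) :
  exists c s : R,
    [/\ c ^+ 2 + s ^+ 2 = 1, 0 <= c * x + s * y & - s * x + c * y = 0].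
Proof.
have [xy0|xy0] := eqVneq (x ^+ 2 + y ^+ 2) 0.
  have x0 : x = 0 by nra.
  have y0 : y = 0 by nra.
  by exists 1, 0; rewrite x0 y0 !mulr0 addr0 expr1n expr0n addr0.
pose r := Num.sqrt (x ^+ 2 + y ^+ 2).
have r2 : r ^+ 2 = x ^+ 2 + y ^+ 2 by rewrite sqr_sqrtr //; nra.
have r0 : r != 0 by apply: contra_neq xy0 => r0; rewrite -r2 r0 expr0n.
exists (x / r), (y / r); split.
- by rewrite !expr_div_n -mulrDl -r2 divff // expf_neq0.
- have -> : x / r * x + y / r * y = r ^+ 2 / r by rewrite r2; field.
  by rewrite divr_ge0 ?sqr_ge0 // sqrtr_ge0.
- by field.
Qed.

(** * Givens elimination in SO(n) *)

Lemma block_givens (R : pzRingType) (n : nat) (a b : 'I_n) (c s : R) :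
  block_mx 1%:M 0 0 (givens a b c s) =
  givens (rshift 1 a) (rshift 1 b) c s :> 'M[R]_(1 + n).
Proof.
apply/matrixP => i j.
case: (split_ordP i) => i' ->; case: (split_ordP j) => j' ->;
  rewrite ?block_mxEul ?block_mxEur ?block_mxEdl ?block_mxEdr !mxE;
  by rewrite ?eq_rshift ?eq_lshift ?eq_rlshift ?eq_lrshift ?mulr0 ?addr0 ?if_same.
Qed.

(** Since column 0 vanishes below the top, row 0 of the identity A^T A = 1 reads A_00 A_0j =
    delta_0j. Hence A_00 = 1 by its sign, and the rest of row 0 vanishes. *)
Lemma orthogonal_col0 (R : realType) (n : nat) (A : 'M[R]_(1 + n)) :
  orthogonal_group A -> (forall i, A (rshift 1 i) 0 = 0) -> 0 <= A 0 0 ->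
  A = block_mx 1%:M 0 0 (drsubmx A).
Proof.
move=> /orthogonal_mulTmx AA A0 A00.
have col0 j : A 0 0 * A 0 j = (0 == j)%:R.
  have /matrixP/(_ 0 j) := AA; rewrite !mxE big_ord_recl big1 ?addr0 => [<-|i _].
    by rewrite !mxE.
  by rewrite !mxE (_ : lift ord0 i = rshift 1 i) ?A0 ?mul0r //; exact: val_inj.
have A001 : A 0 0 = 1.
  by have := col0 0; rewrite eqxx -expr2 => /eqP; rewrite sqrp_eq1 // => /eqP.
rewrite -[LHS]submxK; congr block_mx; apply/matrixP => i j; rewrite !mxE.
- by rewrite !ord1 (_ : lshift n 0 = 0) //; exact: val_inj.
- rewrite ord1 (_ : lshift n 0 = 0); last exact: val_inj.
  by rewrite -[LHS]mul1r -A001 col0.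
- by rewrite ord1 (_ : lshift n 0 = 0) ?A0 //; exact: val_inj.
Qed.

(** Induction on n with L arbitrary: the hypothesis is applied to the preimage of L under C ->
    diag(1, C). The inverse of a rotation is a rotation in the same plane, so closure of L under
    products suffices. *)
Lemma special_orthogonal_sub_of_givens (R : realType) (n : nat)
    (L : set 'M[R]_n) :
  L 1%:M -> (forall A B, L A -> L B -> L (A *m B)) ->
  (forall (a b : 'I_n) c s, b = a.+1 :> nat -> c ^+ 2 + s ^+ 2 = 1 ->
     L (givens a b c s)) ->
  @special_orthogonal_group R n `<=` L.
Proof.
elim: n => [|[|n] IH] in L *.
- by move=> L1 _ _ A _; rewrite (_ : A = 1%:M) // [LHS]flatmx0 [RHS]flatmx0.
(* In size 1 no rotation takes place, and the sign of the only entry comes from the determinant. *)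
- move=> L1 _ _ A [_ dA]; rewrite (_ : A = 1%:M) //.
  by rewrite [A]mx11_scalar -det_mx11 dA.
move=> L1 LM LG.
(* Eliminate the first column from the bottom up: all entries below row k already
   vanish, and after the first rotation the entry in row k is nonnegative. *)
suff key k : (k <= n.+1)%N -> forall A, special_orthogonal_group A ->
    (forall i : 'I_n.+2, (k < i)%N -> A i 0 = 0) ->
    ((k < n.+1)%N -> 0 <= A (inord k) 0) -> L A.
  (* At k = n.+1, the last row, both conditions on column 0 are vacuous. *)
  move=> A SA; apply: (key n.+1) => // [i|]; last by rewrite ltnn.
  by rewrite ltnNge -ltnS ltn_ord.
elim: k => [_|k IHk kn] A SA A0 Ak.
  have {}Ak : 0 <= A ord0 0.
    have <- : inord 0 = ord0 :> 'I_n.+2 by apply: val_inj; rewrite /= inordK.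
    exact: Ak.
  have [oA dA] := SA.
  have EA := @orthogonal_col0 R n.+1 A oA (fun i => A0 (rshift 1 i) isT) Ak.
  move: (drsubmx _) EA oA dA => B -> oA dA.
  pose L' := [set C : 'M[R]_n.+1 | L (@block_mx _ 1 n.+1 1 n.+1 1%:M 0 0 C)].
  suff : L' B by [].
  apply: IH => /=.
  - by rewrite /L' /= -scalar_mx_block.
  - move=> C D LC LD; have := LM _ _ LC LD.
    by rewrite (@mulmx_block _ 1 n.+1 1 n.+1 1 n.+1) !mul0mx !mulmx0 mulmx1 !addr0 !add0r.
  - by move=> a b c s ab cs; rewrite /L' /= block_givens; apply: LG; rewrite //= ab.
  split.
    move: oA; rewrite /orthogonal_group /= (@tr_block_mx _ 1 n.+1 1 n.+1).
    rewrite (@mulmx_block _ 1 n.+1 1 n.+1 1 n.+1).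
    rewrite !trmx0 !mul0mx !mulmx0 trmx1 mulmx1 !addr0 !add0r.
    by rewrite (@scalar_mx_block _ 1 n.+1) => /(@eq_block_mx _ 1 n.+1 1 n.+1)[].
  by move: dA; rewrite (@det_ublock _ 1 n.+1) det1 mul1r.
pose a : 'I_n.+2 := inord k; pose b : 'I_n.+2 := inord k.+1.
have va : a = k :> nat by rewrite inordK //; lia.
have vb : b = k.+1 :> nat by rewrite inordK //; lia.
have ab : a != b by rewrite -val_eqE /= va vb; lia.
have [c [s [cs r0 y0]]] := exists_rotation (A a 0) (A b 0).
(* The left factor is a rotation, hence in L. The right factor has its entry in row k.+1 of column 0
   cleared and the one in row k made nonnegative, as the hypothesis for k requires. *)
have -> : A = givens a b c (- s) *m (givens a b c s *m A).
  rewrite mulmxA -givens_tr // orthogonal_mulTmx ?mul1mx //.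
  exact: givens_orthogonal.
apply: LM; first by apply: LG; rewrite ?va ?vb ?sqrrN.
apply: IHk; first by lia.
- exact/special_orthogonal_mul/SA/givens_special_orthogonal.
- move=> i ki; rewrite givens_mulE.
  have /negPf -> : i != a by rewrite -val_eqE /= va; lia.
  case: eqP => // /eqP; rewrite -val_eqE /= vb => ib.
  by apply: A0; lia.
- by rewrite givens_mulE eqxx.
Qed.

(** * Block groups and cut points *)

Lemma mul_mxdiag (R : pzSemiRingType) (r : nat) (p : 'I_r -> nat)
    (B C : forall j, 'M[R]_(p j)) :
  \mxdiag_j B j *m \mxdiag_j C j = \mxdiag_j (B j *m C j).
Proof.
rewrite [X in X *m _ = _]/mxdiag mul_mxblock_mxdiag; apply/eq_mxblock => i j.
by case: eqVneq => [<-|_]; rewrite ?conform_mx_id ?mul0mx.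
Qed.

Lemma det_mxdiag (R : comPzRingType) (r : nat) (p : 'I_r -> nat)
    (B : forall j, 'M[R]_(p j)) :
  \det (\mxdiag_j B j) = \prod_j \det (B j).
Proof.
elim: r p B => [|r IH] p B.
  rewrite [RHS]big_ord0; move: (mxdiag _).
  by rewrite [(\sum_(i < 0) _)%N]big_ord0 => A; exact: det_mx00.
have det_cast m n (e : m = n) (A : 'M[R]_m) : \det (castmx (e, e) A) = \det A.
  by case: _ / e; rewrite castmx_id.
by rewrite mxdiag_recl [RHS]big_ord_recl -IH det_cast det_ublock.
Qed.

Lemma block_group_sub (R : realType) (G G' : forall n, set 'M[R]_n)
    (N r : nat) (p : r.-tuple nat) (sum_p : (\sum_(j < r) tnth p j)%N = N) :
  (forall n, G n `<=` G' n) -> block_group G sum_p `<=` block_group G' sum_p.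
Proof. by move=> GG' A [B GB ->]; exists B => // j; exact: GG'. Qed.

Lemma block_group_orthogonal (R : realType) (N r : nat) (p : r.-tuple nat)
    (sum_p : (\sum_(j < r) tnth p j)%N = N) :
  block_group (@orthogonal_group R) sum_p `<=` @orthogonal_group R N.
Proof.
case: _ / sum_p => A [B oB ->]; rewrite castmx_id /orthogonal_group /=.
rewrite tr_mxdiag mul_mxdiag -mxdiagZ; apply/eq_mxdiag => j; exact: oB.
Qed.

Lemma block_group_special_orthogonal (R : realType) (N r : nat)
    (p : r.-tuple nat) (sum_p : (\sum_(j < r) tnth p j)%N = N) :
  block_group (@special_orthogonal_group R) sum_p
  `<=` @special_orthogonal_group R N.
Proof.
move=> A bA; split.
  apply: (@block_group_orthogonal _ _ _ _ sum_p).
  by apply: (block_group_sub (G := @special_orthogonal_group R)) bA => n B [].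
move: A bA; case: _ / sum_p => A [B oB ->].
by rewrite castmx_id det_mxdiag big1 // => j _; have [] := oB j.
Qed.

Definition block_index (N r : nat) (p : r.-tuple nat)
    (sum_p : (\sum_(j < r) tnth p j)%N = N) (i : 'I_N) : 'I_r :=
  tagnat.sig1 (cast_ord (esym sum_p) i).

(* cut p a = p_1 + ... + p_a, which stays equal to the full sum for a >= r. *)
Definition cut (r : nat) (p : r.-tuple nat) (a : nat) : nat :=
  \sum_(j < r | (j < a)%N) tnth p j.

Lemma cut_leq (r : nat) (p : r.-tuple nat) (a b : nat) :
  (a <= b)%N -> (cut p a <= cut p b)%N.
Proof.
move=> ab; rewrite /cut [leqLHS]big_mkcond [leqRHS]big_mkcond.
apply: leq_sum => j _; case: ifP => // ja.
by rewrite (leq_trans ja ab).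
Qed.

Lemma cutS (r : nat) (p : r.-tuple nat) (j : 'I_r) :
  cut p j.+1 = (cut p j + tnth p j)%N.
Proof.
rewrite /cut (bigD1 j) //= addnC; congr (_ + _)%N; apply: eq_bigl => k.
by rewrite ltnS [RHS]ltn_neqAle andbC.
Qed.

Lemma cut_block_index (N r : nat) (p : r.-tuple nat)
    (sum_p : (\sum_(j < r) tnth p j)%N = N) (i : 'I_N) :
  (cut p (block_index sum_p i) <= i < cut p (block_index sum_p i).+1)%N.
Proof.
case: _ / sum_p i => i; rewrite /block_index cast_ord_id cutS.
by rewrite [i : nat]tagnat.rect leq_addr ltn_add2l ltn_ord.
Qed.

(** A Galois connection between [cut] and [block_index]: the position of a coordinate relative to a
    cut point becomes a comparison of block indices. *)
Lemma ltn_cut_block_index (N r : nat) (p : r.-tuple nat)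
    (sum_p : (\sum_(j < r) tnth p j)%N = N) (i : 'I_N) (a : nat) :
  (i < cut p a)%N = (block_index sum_p i < a)%N.
Proof.
have /andP[lei ilt] := cut_block_index sum_p i.
have [ba|ab] := ltnP (block_index sum_p i) a; first exact: leq_trans ilt (cut_leq p ba).
by apply/negbTE; rewrite -leqNgt (leq_trans (cut_leq p ab)).
Qed.

(** The block of k starts exactly at k: its start is at most k, and it exceeds i because i lies in
    an earlier block. The witness, the index of that block, counts the blocks before it; it is
    positive for the same reason. *)
Lemma block_index_neq (N r : nat) (p : r.-tuple nat)
    (sum_p : (\sum_(j < r) tnth p j)%N = N) (i k : 'I_N) :
  k = i.+1 :> nat -> block_index sum_p i != block_index sum_p k ->
  exists a : nat, (1 <= a <= r)%N /\ cut p a = k.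
Proof.
move=> ki neq; exists (block_index sum_p k).
have /andP[lek _] := cut_block_index sum_p k.
have leik : (block_index sum_p i <= block_index sum_p k)%N.
  rewrite -ltnS -(ltn_cut_block_index sum_p).
  by have /andP[_] := cut_block_index sum_p k; apply: leq_trans; rewrite ki ltnS.
have ltik : (block_index sum_p i < block_index sum_p k)%N.
  by rewrite ltn_neqAle leik andbT.
split; first by rewrite (leq_ltn_trans _ ltik) //= ltnW.
apply/eqP; rewrite eqn_leq lek ki /=.
by rewrite ltn_cut_block_index.
Qed.

Lemma block_group_index (R : realType) (G : forall n, set 'M[R]_n)
    (N r : nat) (p : r.-tuple nat) (sum_p : (\sum_(j < r) tnth p j)%N = N) A :
  block_group G sum_p A ->
  forall i j, block_index sum_p i != block_index sum_p j -> A i j = 0.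
Proof.
case: _ / sum_p A => A [B GB ->] i j; rewrite castmx_id /block_index !cast_ord_id.
by move=> /negPf ij; rewrite mxE ij mxE.
Qed.

(** A converse to [block_group_index]: for orthogonal matrices, membership is just a pattern of
    zeros, free of casts and families of blocks. Comparing diagonal blocks in A A^T = 1 makes each
    block orthogonal. *)
Lemma mem_block_group (R : realType)
    (N r : nat) (p : r.-tuple nat) (sum_p : (\sum_(j < r) tnth p j)%N = N) A :
  orthogonal_group A ->
  (forall i j, block_index sum_p i != block_index sum_p j -> A i j = 0) ->
  block_group (@orthogonal_group R) sum_p A.
Proof.
case: _ / sum_p A => A oA A0.
have EA : A = \mxdiag_j submxblock A j j.
  rewrite -[LHS]submxblockK; apply/eq_mxblock => i j.
  case: eqVneq => [<-|ij]; rewrite ?conform_mx_id //.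
  apply/matrixP => x y; rewrite !mxE A0 // /block_index !cast_ord_id.
  by rewrite !tagnat.Rank1K.
exists (fun j => submxblock A j j); last by rewrite castmx_id.
move=> j; move: oA; rewrite /orthogonal_group /= {1 2}EA tr_mxdiag mul_mxdiag.
by rewrite -mxdiagZ => /eq_mxdiagP /(_ j).
Qed.

Lemma block_group_square (R : realType) (N r : nat) (p : r.-tuple nat)
    (sum_p : (\sum_(j < r) tnth p j)%N = N) A :
  block_group (@orthogonal_group R) sum_p A ->
  block_group (@special_orthogonal_group R) sum_p (A *m A).
Proof.
case: _ / sum_p A => A [B oB ->]; rewrite castmx_id mul_mxdiag.
exists (fun j => B j *m B j); last by rewrite castmx_id.
move=> j; split; first exact: orthogonal_mul.
by rewrite det_mulmx -expr2 det_orthogonal_sqr.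
Qed.

(** The half-angle rotation has the zero pattern of the orthogonal block group; squaring it lands in
    the special one, with no determinant of a block computed. *)
Lemma givens_block_group (R : realType) (N r : nat) (p : r.-tuple nat)
    (sum_p : (\sum_(j < r) tnth p j)%N = N) (a b : 'I_N) (c s : R) :
  a != b -> block_index sum_p a = block_index sum_p b ->
  c ^+ 2 + s ^+ 2 = 1 ->
  block_group (@special_orthogonal_group R) sum_p (givens a b c s).
Proof.
move=> ab Eab cs; have [c' [s' [cs' ->]]] := givens_square ab cs.
apply: block_group_square; apply: mem_block_group => [|i j ij].
  exact: givens_orthogonal.
have ne k : block_index sum_p k != block_index sum_p j -> (k == j) = false.
  by move=> kj; apply: contra_neqF kj => /eqP ->.
rewrite mxE (ne i) //; case: eqP => [ia|_]; last case: eqP => [ib|//].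
  by rewrite !ne ?mulr0 ?addr0 // -?Eab -ia.
by rewrite !ne ?mulr0 ?addr0 // ?Eab -ib.
Qed.

(** The matrix diag(-1, 1, ..., 1) is diagonal, so it respects every block structure. *)
Lemma exists_block_reflection (R : realType) (N r : nat) (p : r.-tuple nat)
    (sum_p : (\sum_(j < r) tnth p j)%N = N) :
  (0 < N)%N ->
  exists2 D, block_group (@orthogonal_group R) sum_p D & \det D = -1.
Proof.
case: N sum_p => // N sum_p _.
pose d : 'rV[R]_N.+1 := \row_i (if i == ord0 then -1 else 1).
exists (diag_mx d); last first.
  rewrite det_diag (bigD1 ord0) //= big1 ?mulr1 ?mxE // => i /negPf i0.
  by rewrite mxE i0.
apply: mem_block_group => [|i j].
  rewrite /orthogonal_group /= tr_diag_mx mulmx_diag -[1%:M]diag_const_mx.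
  congr diag_mx; apply/rowP => i; rewrite !mxE.
  by case: ifP; rewrite ?mulrNN mulr1.
by rewrite mxE; case: (i =P j) => [->|]; rewrite ?eqxx.
Qed.

(** * Closed subgroups of O(N) *)

Lemma sum_continuous (R : realType) (T : topologicalType) (I : Type)
    (s : seq I) (P : pred I) (f : I -> T -> R) :
  (forall i, continuous (f i)) ->
  continuous (fun x => \sum_(i <- s | P i) f i x).
Proof.
by move=> cf; apply: continuous_big => [|i _]; [exact: add_continuous|exact: cf].
Qed.

Lemma mul_fun_continuous (R : realType) (T : topologicalType) (f g : T -> R) :
  continuous f -> continuous g -> continuous (fun x => f x * g x).
Proof. by move=> cf cg x; apply: cvgM; [exact: cf | exact: cg]. Qed.

Lemma prod_continuous (R : realType) (T : topologicalType) (I : Type)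
    (s : seq I) (P : pred I) (f : I -> T -> R) :
  (forall i, continuous (f i)) ->
  continuous (fun x => \prod_(i <- s | P i) f i x).
Proof.
by move=> cf; apply: continuous_big => [|i _]; [exact: mul_continuous|exact: cf].
Qed.

Lemma det_continuous (R : realType) (n : nat) :
  continuous (fun A : 'M[R]_n => \det A).
Proof.
apply: sum_continuous => s; apply: mul_fun_continuous.
  by move=> A; exact: cst_continuous.
by apply: prod_continuous => i; exact: coord_continuous.
Qed.

Lemma closed_fiber (R : realType) (T : topologicalType) (f : T -> R) (y : R) :
  continuous f -> closed [set x | f x = y].
Proof.
move=> cf; apply: (@preimage_closed _ _ f [set z | z = y]); last exact: closed_eq.
by move=> x _; exact: cf.
Qed.

Lemma closed_orthogonal (R : realType) (n : nat) :
  closed (@orthogonal_group R n).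
Proof.
(* Orthogonality as a family of equations between rows, each the fiber of a continuous real
   function. *)
have -> : @orthogonal_group R n = \bigcap_(ij in [set: 'I_n * 'I_n])
    [set A : 'M[R]_n | \sum_k A ij.1 k * A ij.2 k = (ij.1 == ij.2)%:R].
  apply/seteqP; split=> [A AA [i j] _ /=|A AA].
    have /matrixP/(_ i j) := AA; rewrite !mxE => <-.
    by apply: eq_bigr => k _; rewrite mxE.
  apply/matrixP => i j; rewrite !mxE -(AA (i, j) I).
  by apply: eq_bigr => k _; rewrite mxE.
apply: closed_bigI => ij _; apply: closed_fiber; apply: sum_continuous => k.
by apply: mul_fun_continuous; exact: coord_continuous.
Qed.

Lemma orthogonal_inv (R : realType) (n : nat) (A : 'M[R]_n) :
  orthogonal_group A -> invmx A = A^T.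
Proof.
move=> oA; have [uA _] := mulmx1_unit oA.
by rewrite -[LHS]mulmx1 -oA mulmxA mulVmx // mul1mx.
Qed.

Lemma orthogonal_tr (R : realType) (n : nat) (A : 'M[R]_n) :
  orthogonal_group A -> orthogonal_group A^T.
Proof. by move=> oA; rewrite /orthogonal_group /= trmxK orthogonal_mulTmx. Qed.

Lemma orthogonal1 (R : realType) (n : nat) : @orthogonal_group R n 1%:M.
Proof. by rewrite /orthogonal_group /= trmx1 mulmx1. Qed.

Lemma closed_subgroup_orthogonal (R : realType) (n : nat) :
  closed_subgroup (@orthogonal_group R n).
Proof.
split=> // [|A B|A oA|]; first exact: orthogonal1.
- exact: orthogonal_mul.
- by rewrite orthogonal_inv //; exact: orthogonal_tr.
- exact: closed_orthogonal.
Qed.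

Lemma closed_subgroup_special_orthogonal (R : realType) (n : nat) :
  closed_subgroup (@special_orthogonal_group R n).
Proof.
split=> [A []//||A B|A [oA dA]|].
- by split; [exact: orthogonal1 | exact: det1].
- exact: special_orthogonal_mul.
- by rewrite orthogonal_inv //; split; [exact: orthogonal_tr | rewrite det_tr].
- apply: (@closedI _ (@orthogonal_group R n) [set A | \det A = 1]).
    exact: closed_orthogonal.
  by apply: closed_fiber; exact: det_continuous.
Qed.

(** For c <= N this is O(c) x O(N - c). Encoding it by zero entries avoids casts and makes each
    condition visibly closed. *)
Definition split_orthogonal_group (R : realType) (N c : nat) : set 'M[R]_N :=
  [set A | orthogonal_group A /\
    forall i j : 'I_N, (i < c)%N != (j < c)%N -> A i j = 0].

Lemma closed_subgroup_split (R : realType) (N c : nat) :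
  closed_subgroup (@split_orthogonal_group R N c).
Proof.
split=> [A []//||A B [oA A0] [oB B0]|A [oA A0]|].
- split=> [|i j]; first exact: orthogonal1.
  by rewrite mxE; case: (i =P j) => [->|]; rewrite ?eqxx.
- split=> [|i j ij]; first exact: orthogonal_mul.
  rewrite mxE big1 // => k _.
  (* As i and j lie on opposite sides of c, the index k is separated from one of them. *)
  have [ik|ik] := eqVneq (i < c)%N (k < c)%N; last by rewrite A0 ?mul0r.
  by rewrite B0 ?mulr0 // -ik.
- rewrite orthogonal_inv //; split=> [|i j ij]; first exact: orthogonal_tr.
  by rewrite mxE A0 // eq_sym.
- have -> : @split_orthogonal_group R N c = @orthogonal_group R N `&`
      \bigcap_(ij in [set ij : 'I_N * 'I_N | (ij.1 < c)%N != (ij.2 < c)%N])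
        [set A : 'M[R]_N | A ij.1 ij.2 = 0].
    apply/seteqP; split=> A [oA A0]; split=> //; first by move=> ij; exact: A0.
    by move=> i j ij; exact: (A0 (i, j)).
  apply: closedI; first exact: closed_orthogonal.
  by apply: closed_bigI => ij _; apply: closed_fiber; exact: coord_continuous.
Qed.

Lemma block_group_split (R : realType) (N r : nat) (p : r.-tuple nat)
    (sum_p : (\sum_(j < r) tnth p j)%N = N) (a : nat) :
  block_group (@orthogonal_group R) sum_p
  `<=` @split_orthogonal_group R N (cut p a).
Proof.
move=> A bA; split=> [|i j]; first exact: block_group_orthogonal bA.
rewrite !(ltn_cut_block_index sum_p) => ij; apply: (block_group_index bA).
by apply: contra_neq ij => ->.
Qed.

(** * The two implications *)

Lemma special_orthogonal_not_split (R : realType) (N c : nat) :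
  (0 < c < N)%N ->
  ~ @special_orthogonal_group R N `<=` @split_orthogonal_group R N c.
Proof.
move=> /andP[c0 cN] sub.
(* The coordinates c - 1 and c on either side of the cut, distinct since c > 0. The quarter turn in
   their plane has entry 1 at (a, b). *)
pose a := Ordinal (leq_ltn_trans (leq_pred c) cN); pose b := Ordinal cN.
have ab : a != b by rewrite -val_eqE /=; lia.
have /sub[_ /(_ a b)] : special_orthogonal_group (givens a b 0 1 : 'M[R]_N).
  by apply: givens_special_orthogonal => //; rewrite expr0n expr1n add0r.
rewrite /= mxE !eqxx mul1r mul0r add0r ltnn prednK // leqnn.
by move=> /(_ isT) /eqP; rewrite oner_eq0.
Qed.

(** Upper bounds on H and K, and failure to contain even SO(N), let one statement serve both the
    orthogonal and the connected case. *)
Lemma common_partition_split (R : realType) (N r s : nat)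
    (p : r.-tuple nat) (q : s.-tuple nat)
    (sum_p : (\sum_(j < r) tnth p j)%N = N)
    (sum_q : (\sum_(i < s) tnth q i)%N = N) (H K : set 'M[R]_N) (N' : nat) :
  H `<=` block_group (@orthogonal_group R) sum_p ->
  K `<=` block_group (@orthogonal_group R) sum_q ->
  (forall j, 2 <= tnth p j)%N -> (N' < N)%N -> common_partition p q N' ->
  ~ @special_orthogonal_group R N `<=` topologically_generated H K.
Proof.
move=> Hp Kq p2 N'N [a [b [/andP[a1 ar] _ pa qb]]] sub.
apply: (@special_orthogonal_not_split R N N').
  (* N' is positive: as 1 <= a, the sum includes the first part, which is at least 2. *)
  rewrite N'N andbT -pa.
  have r0 : (0 < r)%N by exact: leq_trans ar.
  by rewrite (bigD1 (Ordinal r0)) //= addn_gt0 (leq_trans _ (p2 _)).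
apply: subset_trans sub _; apply: smallest_sub; first exact: closed_subgroup_split.
move=> A [/Hp|/Kq].
  by rewrite -pa; exact: block_group_split.
by rewrite -qb; exact: block_group_split.
Qed.

(** Dually, lower bounds on H and K serve both cases. Every closed subgroup containing H and K is
    shown to contain all rotations in planes of consecutive coordinates. *)
Lemma special_orthogonal_sub_generated (R : realType) (N r s : nat)
    (p : r.-tuple nat) (q : s.-tuple nat)
    (sum_p : (\sum_(j < r) tnth p j)%N = N)
    (sum_q : (\sum_(i < s) tnth q i)%N = N) (H K : set 'M[R]_N) :
  block_group (@special_orthogonal_group R) sum_p `<=` H ->
  block_group (@special_orthogonal_group R) sum_q `<=` K ->
  (forall N' : nat, (N' < N)%N -> ~ common_partition p q N') ->
  @special_orthogonal_group R N `<=` topologically_generated H K.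
Proof.
move=> pH qK nocommon A SA L [[_ L1 LM _ _] HKL].
apply: (special_orthogonal_sub_of_givens L1 LM) SA => a b c s' ab cs.
have neq : a != b by rewrite -val_eqE /= ab; lia.
apply: HKL; have [Ep|np] := eqVneq (block_index sum_p a) (block_index sum_p b).
  by left; apply: pH; exact: givens_block_group.
have [Eq|nq] := eqVneq (block_index sum_q a) (block_index sum_q b).
  by right; apply: qK; exact: givens_block_group.
(* If a and b are separated in both partitions, then b itself is a shared cut point below N. *)
have [u [ur pu]] := block_index_neq ab np.
have [v [vs qv]] := block_index_neq ab nq.
by case: (nocommon b (ltn_ord b)); exists u, v; split.
Qed.

Theorem proposition5p3 (R : realType) (N r s : nat)
    (piH : r.-tuple nat) (piK : s.-tuple nat)
    (sum_piH : (\sum_(j < r) tnth piH j)%N = N)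
    (sum_piK : (\sum_(i < s) tnth piK i)%N = N)
    (sorted_piH : sorted leq piH) (sorted_piK : sorted leq piK)
    (piH_neq_piK : (piH : seq nat) <> (piK : seq nat))
    (piH_ge2 : forall j : 'I_r, (2 <= tnth piH j)%N)
    (piK_ge2 : forall i : 'I_s, (2 <= tnth piK i)%N) :
  ((forall N' : nat, (N' < N)%N -> ~ common_partition piH piK N') <->
   topologically_generated
     (block_group (@orthogonal_group R) sum_piH)
     (block_group (@orthogonal_group R) sum_piK)
   = @orthogonal_group R N)
  /\
  ((forall N' : nat, (N' < N)%N -> ~ common_partition piH piK N') <->
   topologically_generated
     (block_group (@special_orthogonal_group R) sum_piH)
     (block_group (@special_orthogonal_group R) sum_piK)
   = @special_orthogonal_group R N).
Proof.
have SO_O n : @special_orthogonal_group R n `<=` @orthogonal_group R n.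
  by move=> A [].
have bH := @block_group_sub R _ _ N r piH sum_piH SO_O.
have bK := @block_group_sub R _ _ N s piK sum_piK SO_O.
split; split=> [nocommon|gen N' N'N common].
- apply/seteqP; split.
    apply: smallest_sub; first exact: closed_subgroup_orthogonal.
    by move=> A []; exact: block_group_orthogonal.
  have subSO := special_orthogonal_sub_generated bH bK nocommon.
  move=> A oA; have := det_orthogonal_sqr oA => /eqP.
  rewrite sqrf_eq1 => /orP[/eqP dA|/eqP dA]; first exact: subSO.
  (* For N = 0 the determinant is 1, which contradicts \det A = -1. *)
  have N0 : (0 < N)%N.
    rewrite lt0n; apply/negP => /eqP N0; move: A oA dA {subSO}.
    rewrite N0 => A _; rewrite det_mx00 => /eqP.
    by rewrite -addr_eq0 -(natrD _ 1 1) pnatr_eq0.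
  have [D bD dD] := exists_block_reflection R sum_piH N0.
  have oD := block_group_orthogonal bD.
  (* D^T is the inverse of a reflection in H, and D A has determinant 1, so the SO(N) inclusion
     covers it. *)
  have -> : A = D^T *m (D *m A) by rewrite mulmxA orthogonal_mulTmx ?mul1mx.
  move=> L [LG HKL]; have [_ _ LM LV _] := LG.
  apply: LM; first by rewrite -orthogonal_inv //; apply: LV; apply: HKL; left.
  apply: subSO => //; split; first exact: orthogonal_mul.
  by rewrite det_mulmx dD dA mulrNN mulr1.
- apply: (common_partition_split (R := R) (sum_p := sum_piH) (sum_q := sum_piK)
    (fun A HA => HA) (fun A KA => KA) piH_ge2 N'N common).
  by rewrite gen; exact: SO_O.
- apply/seteqP; split.
    apply: smallest_sub; first exact: closed_subgroup_special_orthogonal.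
    by move=> A []; exact: block_group_special_orthogonal.
  exact: (special_orthogonal_sub_generated (sum_p := sum_piH) (sum_q := sum_piK)).
- apply: (common_partition_split bH bK piH_ge2 N'N common).
  by rewrite gen.
Qed.
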